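(* Let $b>0$, let $C$ be a subset of a real Hilbert space with $\|y\|\le b/2$ for all $y\in C$, and let $T:C\to C$ be nonexpansive. Assume that $0\in C$, $T0=0$, and $\|Ty+Tz\|\leq\|y+z\|$ for all $y,z\in C$. Let $x\in C$. Then for every $\varepsilon>0$ and all functions $g,h:\mathbb N\to\mathbb N$ there is a number $N\leq A_1(\varepsilon,g,h)$ such that $$|\alpha^i_m-\alpha^i_n|<\varepsilon\quad\text{for all } m,n\in[N,N+g(N)]\text{ and all } i\leq h(N).$$
   Context: $\mathbb N=\{0,1,2,\dots\}$, and $[m,n]$ denotes the set of natural numbers $k$ with $m\le k\le n$. Nonexpansive means $\|Ty-Tz\|\le\|y-z\|$ for all $y,z\in C$. Put $\alpha^i_n:=\|T^nx-T^{n+i}x\|$ for $i,n\in\mathbb N$. For $g:\mathbb N\to\mathbb N$ define $\widetilde g(n):=n+g(n)$, with iterates $\widetilde g^0(n):=n$ and $\widetilde g^{i+1}(n):=\widetilde g(\widetilde g^i(n))$. For $\varepsilon>0$ and $g,h:\mathbb N\to\mathbb N$ set $$A_1(\varepsilon,g,h):=\widetilde{g+h}^{\lceil b^2/\varepsilon^2\rceil}(0),$$ i.e. the $\lceil b^2/\varepsilon^2\rceil$-th iterate of $n\mapsto n+g(n)+h(n)$ evaluated at $0$. *)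

(* Defs.v *)
From HB Require Import structures.
From mathcomp Require Import all_boot all_order all_algebra.
From mathcomp Require Import classical_sets reals topology normedtype.
Set Implicit Arguments.
Unset Strict Implicit.
Unset Printing Implicit Defensive.
Import Order.TTheory GRing.Theory Num.Theory.
Import numFieldNormedType.Exports.
Local Open Scope ring_scope.

(* Real Hilbert spaces: complete normed modules over the reals whose norm
   comes from an inner product. *)
HB.mixin Record CompleteNormedModule_isHilbert (R : realType) (H : Type)
    of CompleteNormedModule R H := {
  inner : {dot H for (idfun : R -> R)} ;
  sqr_norm_inner : forall u : H, `|u| ^+ 2 = inner u u
}.

#[short(type="hilbertType")]
HB.structure Definition Hilbert (R : realType) :=
  { H of CompleteNormedModule R H & CompleteNormedModule_isHilbert R H }.

Definition nonexpansive_on (R : realType) (H : normedModType R)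
    (C : set H) (T : H -> H) : Prop :=
  forall y z : H, C y -> C z -> `|T y - T z| <= `|y - z|.

Definition alpha (R : realType) (H : normedModType R)
    (T : H -> H) (x : H) (i n : nat) : R :=
  `|iter n T x - iter (n + i) T x|.

Definition tilde (g : nat -> nat) (n : nat) : nat := (n + g n)%N.

(* Num.ceil is int-valued; the absolute value is harmless since
   b ^+ 2 / eps ^+ 2 >= 0. *)
Definition A1 (R : realType) (b eps : R) (g h : nat -> nat) : nat :=
  iter `|Num.ceil (b ^+ 2 / eps ^+ 2)|%N
    (tilde (fun n => (g n + h n)%N)) 0%N.

(* Main.v *)
Require Import Defs.
From HB Require Import structures.
From mathcomp Require Import all_boot all_order all_algebra.
From mathcomp Require Import classical_sets reals topology normedtype.
From mathcomp Require Import zify lra.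
Set Implicit Arguments.
Unset Strict Implicit.
Unset Printing Implicit Defensive.
Import Order.TTheory GRing.Theory Num.Theory.
Import numFieldNormedType.Exports.
Local Open Scope ring_scope.

(* The parallelogram law gives
     (alpha_n^i)^2 + |T^n x + T^(n+i) x|^2 = 2 |T^n x|^2 + 2 |T^(n+i) x|^2,
   and the sum term is nonincreasing in n, so a drop of (alpha_n^i)^2 over
   [N, N + g N] is at most four times the drop of |T^n x|^2 over
   [N, N + g N + h N].  As |x|^2 <= b^2 / 4, the iterates of
   n |-> n + g n + h n at 0 with index at most ceil (b^2 / eps^2) cannot all
   have a drop of eps^2 / 4 or more. *)

Lemma parallelogram (R : realType) (H : hilbertType R) (u v : H) :
  `|u - v| ^+ 2 + `|u + v| ^+ 2 = 2 * `|u| ^+ 2 + 2 * `|v| ^+ 2.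
Proof.
rewrite !sqr_norm_inner !(linearDl, linearDr, linearNl, linearNr).
lra.
Qed.

(** Otherwise [K.+1] consecutive drops of at least [e] would add up to more than [a n0] and force a
    negative value. The induction moves the starting point to [f n0]. *)
Lemma small_drop_along_iterates (R : realDomainType) (a : nat -> R)
    (f : nat -> nat) (e : R) (n0 K : nat) :
  (forall n, 0 <= a n) -> a n0 < e *+ K.+1 ->
  exists2 k, (k <= K)%N & a (iter k f n0) - a (iter k.+1 f n0) < e.
Proof.
move=> a_ge0; elim: K n0 => [|K IH] n0 a_lt.
  by exists 0%N => //=; have := a_ge0 (f n0); rewrite mulr1n in a_lt; lra.
have [?|drop] := ltP (a n0 - a (f n0)) e; first by exists 0%N.
have [|k kK small] := IH (f n0); first by rewrite mulrS in a_lt; lra.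
by exists k.+1 => //; rewrite !iterSr in small *.
Qed.

Lemma leq_iter_tilde (f : nat -> nat) (n : nat) :
  {homo (fun k => iter k (tilde f) n) : k l / (k <= l)%N}.
Proof.
by apply: homo_leq => [//|l k m|k]; [exact: leq_trans | exact: leq_addr].
Qed.

Lemma nonincr_homo_leq disp (P : porderType disp) (u : nat -> P) :
  (forall n, u n.+1 <= u n)%O ->
  {homo u : m n / (m <= n)%N >-> (n <= m)%O}.
Proof.
by move=> u_dec; apply: homo_leq => // y z w zy yw; apply: le_trans yw zy.
Qed.

Theorem proposition5p3 (R : realType) (H : hilbertType R) (b : R)
    (C : set H) (T : H -> H) (x : H)
    (b_gt0 : 0 < b)
    (C_bounded : forall y : H, C y -> `|y| <= b / 2)
    (T_maps : forall y : H, C y -> C (T y))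
    (T_nonexp : nonexpansive_on C T)
    (C0 : C 0)
    (T0 : T 0 = 0)
    (T_sum : forall y z : H, C y -> C z -> `|T y + T z| <= `|y + z|)
    (Cx : C x) :
  forall (eps : R), 0 < eps ->
  forall g h : nat -> nat,
  exists N : nat,
    (N <= A1 b eps g h)%N /\
    forall m n i : nat,
      (N <= m <= N + g N)%N -> (N <= n <= N + g N)%N -> (i <= h N)%N ->
      `|alpha T x i m - alpha T x i n| < eps.
Proof.
move=> eps eps_gt0 g h.
pose y n := iter n T x; pose a n : R := `|y n| ^+ 2.
have Cy n : C (y n) by elim: n => //= n; exact: T_maps.
(* Nonexpansiveness is applied against the fixed point 0. *)
have a_dec : {homo a : m n / (m <= n)%N >-> n <= m}.
  apply: nonincr_homo_leq => n; rewrite lerXn2r ?nnegrE //.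
  by have := T_nonexp _ _ (Cy n) C0; rewrite T0 !subr0.
have alpha_dec i : {homo alpha T x i : m n / (m <= n)%N >-> n <= m}.
  by apply: nonincr_homo_leq => n; apply: T_nonexp; apply: Cy.
pose s i n : R := `|y n + y (n + i)%N| ^+ 2.
have s_dec i : {homo s i : m n / (m <= n)%N >-> n <= m}.
  by apply: nonincr_homo_leq => n; rewrite lerXn2r ?nnegrE //; apply: T_sum; apply: Cy.
have plaw i n : alpha T x i n ^+ 2 + s i n = 2 * a n + 2 * a (n + i)%N.
  exact: parallelogram.
pose F := tilde (fun n => (g n + h n)%N).
pose K := `|Num.ceil (b ^+ 2 / eps ^+ 2)|%N.
(* Rounding up gives b^2 / 4 <= [K] eps^2 / 4. The extra summand in [K.+1] makes the bound strict,
   while the index found below is still at most [K], as [A1] demands. *)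
have a0_lt : a 0%N < (eps ^+ 2 / 4) *+ K.+1.
  have eps2_gt0 : 0 < eps ^+ 2 by rewrite exprn_gt0.
  have : b ^+ 2 <= eps ^+ 2 * K%:R.
    rewrite mulrC -ler_pdivrMr // (le_trans (Num.Theory.ceil_ge _)) //.
    by rewrite -[K%:R]/(K%:Z%:~R) ler_int /K abszE ler_norm.
  have : a 0%N <= (b / 2) ^+ 2.
    by rewrite lerXn2r ?nnegrE ?C_bounded // divr_ge0 // ltW.
  rewrite -[_ *+ K.+1]mulr_natr -[K.+1%:R]natr1; lra.
have a_ge0 n : 0 <= a n by exact: sqr_ge0.
have [k kK drop] := small_drop_along_iterates F a_ge0 a0_lt.
set N := iter k F 0%N in drop; exists N; split; first exact: leq_iter_tilde.
(* Since alpha is nonincreasing in its last index, ordering [m] and [n] removes the absolute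
   value. *)
suff main i m n : (i <= h N)%N -> (N <= m)%N -> (m <= n <= N + g N)%N ->
    alpha T x i m - alpha T x i n < eps.
  move=> m n i /andP[Nm mN] /andP[Nn nN] ih.
  have [mn|/ltnW nm] := leqP m n.
    by rewrite ger0_norm ?subr_ge0 ?alpha_dec // main // mn.
  by rewrite distrC ger0_norm ?subr_ge0 ?alpha_dec // main // nm.
move=> ih Nm /andP[mn nN].
(* The indices m, m + i, n and n + i all lie between N and F N = N + g N + h N, so the values of [a]
   there differ by at most the drop over this block. *)
have am := a_dec _ _ Nm.
have ami : a (m + i)%N <= a N by apply: a_dec; lia.
have an : a (iter k.+1 F 0%N) <= a n.
  by apply: a_dec; rewrite /= -/N /F /tilde; lia.
have ani : a (iter k.+1 F 0%N) <= a (n + i)%N.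
  by apply: a_dec; rewrite /= -/N /F /tilde; lia.
have := alpha_dec i _ _ mn; have := s_dec i _ _ mn.
have := plaw i m; have := plaw i n.
have : 0 <= alpha T x i n := normr_ge0 _.
move: (alpha T x i m) (alpha T x i n) => p q q_ge0 eq_n eq_m s_le qp.
rewrite -(ltr_pXn2r (n := 2)) ?nnegrE ?subr_ge0 ?(ltW eps_gt0) //.
(* As 0 <= q <= p, this yields (p - q)^2 <= p^2 - q^2. Subtracting the two parallelogram identities
   bounds the right side by four times the drop, hence strictly below eps^2. *)
have : q ^+ 2 <= p * q by rewrite expr2 ler_wpM2r.
rewrite sqrrB; lra.
Qed.
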